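(* Let $n,d\ge1$ be integers and $k>2$ an integer. Let $X_1,\dots,X_n\in\mathbb{R}^d$ be arbitrary, and suppose the scale parameters satisfy $X_i^{\max}-X_i^{\min}\le s_i\le\sqrt2\,\|X_i\|_2$ for all $i$. Then the stochastic $k$-level quantization protocol $\pi_{sk}$ satisfies $$\mathcal{E}(\pi_{sk},X^n)\;\le\;\frac{d}{2n(k-1)^2}\cdot\frac1n\sum_{i=1}^n\|X_i\|_2^2 .$$
   Context: Client $i$ ($1\le i\le n$) holds $X_i\in\mathbb{R}^d$ with coordinates $X_i(1),\dots,X_i(d)$; $X^n=(X_1,\dots,X_n)$, $\bar X=\frac1n\sum_i X_i$, $X_i^{\max}=\max_j X_i(j)$, $X_i^{\min}=\min_j X_i(j)$. Stochastic $k$-level quantization $\pi_{sk}$ with scales $s_i$, where $X_i^{\min}+s_i\ge X_i^{\max}$: put $B_i(r)=X_i^{\min}+\frac{r s_i}{k-1}$ for integers $0\le r<k$. Independently for all $i,j$: if $X_i(j)\in[B_i(r),B_i(r+1))$, then $Y_i(j)=B_i(r+1)$ with probability $\frac{X_i(j)-B_i(r)}{B_i(r+1)-B_i(r)}$ and $Y_i(j)=B_i(r)$ otherwise; if $X_i(j)=B_i(k-1)$ then $Y_i(j)=X_i(j)$ (in particular $Y_i=X_i$ if $s_i=0$). The server's estimate is $\hat{\bar X}=\frac1n\sum_{i=1}^nY_i$, and $\mathcal{E}(\pi_{sk},X^n)=\mathbb{E}\|\hat{\bar X}-\bar X\|_2^2$, the expectation being over the randomness of the quantization. *)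

(* Defs.v *)
From HB Require Import structures.
From mathcomp Require Import all_boot all_order all_algebra.
From mathcomp Require Import all_classical all_reals all_analysis.
Set Implicit Arguments.
Unset Strict Implicit.
Unset Printing Implicit Defensive.
Import Order.TTheory GRing.Theory Num.Theory.
Local Open Scope classical_set_scope.
Local Open Scope ring_scope.

(* The library norm on ['rV[R]_d] is the sup norm, hence an explicit one. *)
Definition l2norm (R : realType) (d : nat) (x : 'rV[R]_d) : R :=
  Num.sqrt (\sum_(j < d) x 0 j ^+ 2).

(* The base value of the iterated max/min must be a coordinate of the vector
   (0 would be wrong), which is what [0 < d] provides. *)
Definition coordmax (R : realType) (d : nat) (hd : (0 < d)%N)
    (x : 'rV[R]_d) : R :=
  \big[Num.max/x 0 (Ordinal hd)]_(j < d) x 0 j.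

Definition coordmin (R : realType) (d : nat) (hd : (0 < d)%N)
    (x : 'rV[R]_d) : R :=
  \big[Num.min/x 0 (Ordinal hd)]_(j < d) x 0 j.

Definition vmean (R : realType) (n d : nat) (X : 'I_n -> 'rV[R]_d) : 'rV[R]_d :=
  n%:R^-1 *: \sum_(i < n) X i.

Definition level (R : realType) (d : nat) (hd : (0 < d)%N) (k : nat)
    (x : 'rV[R]_d) (s : R) (r : nat) : R :=
  coordmin hd x + r%:R * s / (k%:R - 1).

Definition mutually_independent (R : realType) (disp : measure_display)
    (T : measurableType disp) (P : probability T R) (I : finType)
    (Z : I -> {RV P >-> R}) : Prop :=
  forall (J : {set I}) (A : I -> set R),
    (forall i, measurable (A i)) ->
    P (\bigcap_(i in [set` J]) (Z i @^-1` A i)) =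
    (\prod_(i in J) P (Z i @^-1` A i))%E.

(* Only the law of [Y] is prescribed, so "Y takes the value v" is read almost
   surely; when [s = 0] no half-open cell exists and the last clause applies. *)
Definition rounded_to_level (R : realType) (disp : measure_display)
    (T : measurableType disp) (P : probability T R) (B : nat -> R) (k : nat)
    (a : R) (Y : {RV P >-> R}) : Prop :=
  (forall r : nat, (r.+1 < k)%N -> B r <= a < B r.+1 ->
     let p := (a - B r) / (B r.+1 - B r) in
     P (Y @^-1` [set B r.+1]) = p%:E /\ P (Y @^-1` [set B r]) = (1 - p)%:E) /\
  (a = B k.-1 -> P (Y @^-1` [set a]) = 1%E).

(* [Y i j] is the random j-th coordinate of the message of client i. *)
Definition stochastic_k_level (R : realType) (disp : measure_display)
    (T : measurableType disp) (P : probability T R) (n d : nat)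
    (hd : (0 < d)%N) (k : nat) (X : 'I_n -> 'rV[R]_d) (s : 'I_n -> R)
    (Y : 'I_n -> 'I_d -> {RV P >-> R}) : Prop :=
  (forall i j, rounded_to_level (level hd k (X i) (s i)) k (X i 0 j) (Y i j)) /\
  mutually_independent (fun ij : 'I_n * 'I_d => Y ij.1 ij.2).

Definition mean_squared_error (R : realType) (disp : measure_display)
    (T : measurableType disp) (P : probability T R) (n d : nat)
    (X : 'I_n -> 'rV[R]_d) (Y : 'I_n -> 'I_d -> {RV P >-> R}) : \bar R :=
  ('E_P[(fun w => l2norm (vmean (fun i => \row_(j < d) Y i j w) - vmean X) ^+ 2)%R])%E.

(* Main.v *)
(* Almost surely Y_i(j) - X_i(j) = c (1_A - p) with A = {Y_i(j) = v}, P(A) = p and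
   |c| at most the cell width s_i/(k-1). These errors are centred, they are
   uncorrelated across clients because the events A are independent, and their
   variance is c^2 p (1 - p) <= s_i^2 / (4 (k-1)^2). Hence the mean squared error
   is at most d/(4 n^2 (k-1)^2) sum_i s_i^2, and s_i^2 <= 2 ||X_i||^2. *)
Require Import Defs.
From HB Require Import structures.
From mathcomp Require Import all_boot all_order all_algebra.
From mathcomp Require Import all_classical all_reals all_analysis.
From mathcomp Require Import measurable_realfun ring lra.
Set Implicit Arguments.
Unset Strict Implicit.
Unset Printing Implicit Defensive.
Import Order.TTheory GRing.Theory Num.Theory.
Local Open Scope classical_set_scope.
Local Open Scope ring_scope.

Section Expectation.
Context (R : realType) (disp : measure_display) (T : measurableType disp)
  (P : probability T R).

Lemma expectation_sumfun (I : finType) (f : I -> T -> R) :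
    (forall i, f i \in Lfun P 1) ->
  'E_P[(fun w => \sum_i f i w)%R]%E = (\sum_i 'E_P[f i])%E.
Proof.
move=> lf; rewrite unlock -integral_sum//; last first.
  by move=> i; exact/Lfun1_integrable.
by apply: eq_integral => w _; rewrite sumEFin.
Qed.

(** The square expands into a double sum; its off-diagonal terms vanish in expectation, so only the
    second moments on the diagonal remain. *)
Lemma expectation_sqr_sum_le (I : finType) (g : I -> T -> R) (v : I -> R) :
    (forall i i', g i * g i' \in Lfun P 1) ->
    (forall i i', i != i' -> 'E_P[(g i * g i')%R]%E = 0%E) ->
    (forall i, 'E_P[(g i * g i)%R] <= (v i)%:E)%E ->
  ('E_P[(fun w => (\sum_i g i w) ^+ 2)%R] <= (\sum_i v i)%:E)%E.
Proof.
move=> lg g0 gv.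
have -> : (fun w => (\sum_i g i w) ^+ 2) =
    (fun w => \sum_i (fun w => \sum_i' (g i * g i') w) w).
  apply/funext => w; rewrite expr2 mulr_suml.
  by apply: eq_bigr => i _; rewrite mulr_sumr.
rewrite expectation_sumfun; last first.
  move=> i; rewrite (_ : (fun _ => _) = \sum_i' g i * g i') ?rpred_sum//.
  by apply/funext => w; rewrite fct_sumE.
rewrite -sumEFin; apply: lee_sum => i _; rewrite expectation_sumfun//.
rewrite (bigD1 i)//= big1 ?adde0// => i' ii'.
by rewrite g0 1?eq_sym.
Qed.

Lemma indic_Lfun (A : set T) : measurable A -> (\1_A : T -> R) \in Lfun P 1.
Proof.
by move=> mA; apply/Lfun1_integrable; exact: integrable_indic.
Qed.

Lemma centered_indic_mul_Lfun (A B : set T) (p q : R) :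
    measurable A -> measurable B ->
  (\1_A \- cst p) * (\1_B \- cst q) \in Lfun P 1.
Proof.
move=> mA mB.
have -> : (\1_A \- cst p) * (\1_B \- cst q) =
    (\1_(A `&` B) \- q \o* \1_A \- p \o* \1_B \+ cst (p * q) : T -> R).
  by apply/funext => w; rewrite indicI !mulrfctE /=; ring.
by rewrite rpredD//= ?Lfun_cst// !rpredB//= ?Lfun_scale//= indic_Lfun//;
  exact: measurableI.
Qed.

(** This is the covariance of two indicators. It serves twice: independent [A] and [B] give 0, and
    [A = B] gives the Bernoulli variance [p - p ^+ 2]. *)
Lemma expectation_centered_indic_mul (A B : set T) (p q : R) :
    measurable A -> measurable B -> P A = p%:E -> P B = q%:E ->
  'E_P[((\1_A \- cst p) * (\1_B \- cst q))%R]%E = (P (A `&` B) - (p * q)%:E)%E.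
Proof.
move=> mA mB PA PB.
have := @covarianceE _ _ _ P \1_A \1_B (indic_Lfun mA) (indic_Lfun mB).
have -> : \1_A * \1_B = \1_(A `&` B) :> (T -> R) by rewrite indicI.
rewrite !expectation_indic//; last exact: measurableI.
rewrite PA PB EFinM => <-; last by apply: indic_Lfun; exact: measurableI.
by rewrite covariance.unlock !expectation_indic// PA PB.
Qed.

(** The two events are disjoint and their probabilities add up to 1, so the complement of their
    union is a null set. *)
Lemma ae_two_values (Y : {RV P >-> R}) (u v p : R) : u != v ->
    P (Y @^-1` [set v]) = p%:E -> P (Y @^-1` [set u]) = (1 - p)%:E ->
  \forall w \ae P, Y w = u \/ Y w = v.
Proof.
move=> uv Pv Pu.
have mY y : measurable (Y @^-1` [set y]) by exact: measurable_funPTI.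
have PU : P (Y @^-1` [set u] `|` Y @^-1` [set v]) = 1%E.
  rewrite measureU//; last first.
    by rewrite -subset0 => w [/= -> /eqP]; exact/negP.
  by rewrite -[in RHS](subrK p 1) EFinD -Pu -Pv.
exists (~` (Y @^-1` [set u] `|` Y @^-1` [set v])); split.
- by apply: measurableC; exact: measurableU.
- by rewrite probability_setC ?PU ?subee//; exact: measurableU.
- by [].
Qed.

End Expectation.

(** Below the top level, take the least index whose level exceeds [a]. It is positive because
    [B 0 <= a], and by minimality its predecessor is the left end of the cell. *)
Lemma level_cell (R : realType) (B : nat -> R) (k : nat) (a : R) :
    B 0%N <= a <= B k.-1 ->
  a = B k.-1 \/ exists2 r, (r.+1 < k)%N & B r <= a < B r.+1.
Proof.
move=> /andP[B0a]; rewrite le_eqVlt => /predU1P[|aBk]; first by left.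
right; have ex : exists r, a < B r by exists k.-1.
case: (ex_minnP ex) => -[|r] ar rmin; first by rewrite ltNge B0a in ar.
exists r; first by have := rmin _ aBk; case: k {aBk rmin}.
by rewrite ar andbT leNgt; apply/negP => /rmin; rewrite ltnn.
Qed.

(* [t] packs (v, p, c): the error is almost surely c (1_{Y = v} - p). At the top
   level, where nothing is rounded, c = 0. *)
Lemma rounding_error_ae (R : realType) (disp : measure_display)
    (T : measurableType disp) (P : probability T R) (B : nat -> R) (k : nat)
    (a h : R) (Y : {RV P >-> R}) :
    B 0%N <= a <= B k.-1 -> (forall r, B r.+1 - B r = h) ->
    rounded_to_level B k a Y ->
  exists t : R * R * R, [/\ P (Y @^-1` [set t.1.1]) = t.1.2%:E,
    t.2 ^+ 2 <= h ^+ 2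
    & \forall w \ae P,
        Y w - a = t.2 * (\1_(Y @^-1` [set t.1.1]) w - t.1.2)].
Proof.
move=> aB Bh [Yr Ytop].
case: (level_cell aB) => [/[dup] /Ytop PY _|[r rk ar]].
  exists (a, 1, 0); split => //=; first by rewrite expr0n sqr_ge0.
  exists (~` (Y @^-1` [set a])).
  have mY : measurable (Y @^-1` [set a]) by exact: measurable_funPTI.
  split; first exact: measurableC.
    by rewrite probability_setC// PY subee.
  by move=> w /=; apply: contra_not => ->; rewrite subrr mul0r.
have [/= Pv Pu] := Yr r rk ar.
(* The half-open cell contains [a], hence has positive width; this makes [h] nonzero and the two
   values distinct. *)
move/andP: ar => [Ba aB1]; have BB : B r < B r.+1 by exact: le_lt_trans aB1.
exists (B r.+1, (a - B r) / (B r.+1 - B r), h); split => //=.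
have := ae_two_values (negbT (lt_eqF BB)) Pv Pu.
apply: filterS => w.
have h0 : h != 0 by rewrite -(Bh r) subr_eq0 gt_eqF.
(* Rounding down gives the error [-(a - B r) = - h * p], rounding up gives
   [h - (a - B r) = h * (1 - p)]. *)
rewrite indicE Bh; case=> Yw.
  rewrite memNset/=; last by rewrite Yw => /eqP; rewrite lt_eqF.
  by rewrite Yw; field.
by rewrite mem_set//= Yw -(subrK (B r) (B r.+1)) Bh; field.
Qed.

Lemma mutually_independent_pair (R : realType) (disp : measure_display)
    (T : measurableType disp) (P : probability T R) (I : finType)
    (Z : I -> {RV P >-> R}) (i j : I) (A B : set R) :
    mutually_independent Z -> i != j -> measurable A -> measurable B ->
  P (Z i @^-1` A `&` Z j @^-1` B) = (P (Z i @^-1` A) * P (Z j @^-1` B))%E.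
Proof.
move=> indZ ij mA mB.
(* Mutual independence takes a family of sets over the whole index type; only the values of [C] at
   [i] and [j] enter the intersection. *)
pose C l := if l == i then A else B.
have /(indZ [set i; j]%SET) : forall l, measurable (C l).
  by move=> l; rewrite /C; case: ifP.
have -> : \bigcap_(l in [set` [set i; j]%SET]) (Z l @^-1` C l) =
    Z i @^-1` A `&` Z j @^-1` B.
  apply/seteqP; split => [w H|w [HA HB] l /=].
    split; [have := H i|have := H j]; rewrite /C /= !inE eqxx ?orbT.
      by apply.
    by rewrite (eq_sym j) (negbTE ij); apply.
  by rewrite !inE /C => /orP[]/eqP->; rewrite ?eqxx// (eq_sym j) (negbTE ij).
move=> ->; rewrite big_setU1/= ?inE// big_set1 /C eqxx.
by rewrite (eq_sym j) (negbTE ij).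
Qed.

Lemma coordmin_le (R : realType) (d : nat) (hd : (0 < d)%N) (x : 'rV[R]_d) j :
  coordmin hd x <= x 0 j.
Proof. by rewrite /coordmin; exact: bigmin_le_cond. Qed.

Lemma coordmax_ge (R : realType) (d : nat) (hd : (0 < d)%N) (x : 'rV[R]_d) j :
  x 0 j <= coordmax hd x.
Proof. by rewrite /coordmax; exact: le_bigmax. Qed.

Lemma l2norm_sqr (R : realType) (d : nat) (x : 'rV[R]_d) :
  l2norm x ^+ 2 = \sum_(j < d) x 0 j ^+ 2.
Proof. by rewrite sqr_sqrtr// sumr_ge0// => j _; exact: sqr_ge0. Qed.

Theorem theorem2 (R : realType) (n d k : nat)
    (hn : (0 < n)%N) (hd : (0 < d)%N) (hk : (2 < k)%N)
    (X : 'I_n -> 'rV[R]_d) (s : 'I_n -> R)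
    (hs : forall i : 'I_n,
        coordmax hd (X i) - coordmin hd (X i) <= s i
          <= Num.sqrt 2 * l2norm (X i))
    (disp : measure_display) (T : measurableType disp) (P : probability T R)
    (Y : 'I_n -> 'I_d -> {RV P >-> R})
    (hY : stochastic_k_level hd k X s Y) :
  (mean_squared_error X Y <=
    (d%:R / (2 * n%:R * (k%:R - 1) ^+ 2)
       * (n%:R^-1 * \sum_(i < n) l2norm (X i) ^+ 2))%:E)%E.
Proof.
case: hY => hYr hYi.
have k1 : 0 < k%:R - 1 :> R by rewrite subr_gt0 ltr1n; exact: ltn_trans hk.
have n0 : n%:R != 0 :> R by rewrite pnatr_eq0 -lt0n.
pose h i := s i / (k%:R - 1).
(* The top level is the minimum plus [s i], which the lower bound on [s i] places at or above the
   maximum. *)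
have XB i j : level hd k (X i) (s i) 0 <= X i 0 j
    <= level hd k (X i) (s i) k.-1.
  have /andP[smin _] := hs i; rewrite /level !mul0r addr0 coordmin_le/=.
  have -> : (k.-1)%:R = k%:R - 1 :> R by rewrite -subn1 natrB// ltnW// ltnW.
  rewrite [_ * s i]mulrC mulfK ?gt_eqF// -lerBlDl; apply: le_trans smin.
  by rewrite lerB// coordmax_ge.
have Bh i r : level hd k (X i) (s i) r.+1 - level hd k (X i) (s i) r = h i.
  by rewrite /level /h -natr1; ring.
have /choice[t tP] : forall ij : 'I_n * 'I_d, exists t : R * R * R,
    [/\ P (Y ij.1 ij.2 @^-1` [set t.1.1]) = t.1.2%:E,
      t.2 ^+ 2 <= h ij.1 ^+ 2
      & \forall w \ae P, Y ij.1 ij.2 w - X ij.1 0 ij.2 =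
          t.2 * (\1_(Y ij.1 ij.2 @^-1` [set t.1.1]) w - t.1.2)].
  by move=> [i j]; exact: rounding_error_ae (XB i j) (Bh i) (hYr i j).
pose A ij := Y ij.1 ij.2 @^-1` [set (t ij).1.1].
have mA ij : measurable (A ij) by exact: measurable_funPTI.
pose p ij := (t ij).1.2; pose c ij := (t ij).2.
have PA ij : P (A ij) = (p ij)%:E by case: (tP ij).
have ch ij : c ij ^+ 2 <= h ij.1 ^+ 2 by case: (tP ij).
have Yae : \forall w \ae P, forall ij, Y ij.1 ij.2 w - X ij.1 0 ij.2 =
    c ij * (\1_(A ij) w - p ij).
  by apply: filter_forall => ij; case: (tP ij).
(* Almost sure form of the contribution of client [i] to the error of the mean in coordinate [j]. *)
pose g j i := n%:R^-1 * c (i, j) \*o (\1_(A (i, j)) \- cst (p (i, j))) : T -> R.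
have gM j i i' : g j i * g j i' = (n%:R^-1 * c (i, j) * (n%:R^-1 * c (i', j))) \o*
    ((\1_(A (i, j)) \- cst (p (i, j))) * (\1_(A (i', j)) \- cst (p (i', j)))).
  by apply/funext => w; rewrite /g !mulrfctE /=; ring.
have lgg j i i' : g j i * g j i' \in Lfun P 1.
  by rewrite gM Lfun_scale//; exact: centered_indic_mul_Lfun.
have Egg j i i' : 'E_P[(g j i * g j i')%R]%E =
    ((n%:R^-1 * c (i, j) * (n%:R^-1 * c (i', j)))%:E *
     (P (A (i, j) `&` A (i', j)) - (p (i, j) * p (i', j))%:E))%E.
  rewrite gM -expectation_centered_indic_mul//.
  by rewrite -expectationZl//; exact: centered_indic_mul_Lfun.
have mg j i : measurable_fun setT (g j i).
  by apply: measurable_funM => //; exact: measurable_funB.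
(* The 4 comes from [p * (1 - p) <= 1 / 4], the [n%:R ^+ 2] from averaging. *)
pose v i := h i ^+ 2 / (4 * n%:R ^+ 2).
have Ej j : ('E_P[(fun w => (\sum_i g j i w) ^+ 2)%R] <= (\sum_i v i)%:E)%E.
  apply: expectation_sqr_sum_le => // [i i' ii'|i].
    (* Off the diagonal: distinct clients at the same coordinate are independent, so the covariance
       is 0. *)
    have ij : (i, j) != (i', j) by apply: contra ii' => /eqP[->].
    have := mutually_independent_pair hYi ij (measurable_set1 (t (i, j)).1.1)
      (measurable_set1 (t (i', j)).1.1).
    rewrite /= -/(A (i, j)) -/(A (i', j)) !PA => PAA.
    by rewrite Egg PAA (EFinM (p _)) subee ?mule0.
  rewrite Egg setIid PA -EFinB -EFinM lee_fin /v.
  rewrite [leLHS](_ : _ =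
    n%:R ^- 2 * (c (i, j) ^+ 2 * (p (i, j) - p (i, j) ^+ 2))); last by field.
  rewrite [leRHS](_ : _ = n%:R ^- 2 * (h i ^+ 2 / 4)); last by field.
  rewrite ler_wpM2l ?invr_ge0 ?sqr_ge0//.
  have := ch (i, j); have := sqr_ge0 (c (i, j)).
  (* The square gives [p - p ^+ 2 <= 1 / 4]; multiply by [c ^+ 2 >= 0], then use
     [c ^+ 2 <= h ^+ 2]. *)
  have := sqr_ge0 (p (i, j) - 1 / 2) => /=; nra.
(* The true errors agree with the [g j i] only almost surely, so the exchange is made under the
   integral, with both integrands measurable. *)
have -> : mean_squared_error X Y =
    'E_P[(fun w => \sum_j (\sum_i g j i w) ^+ 2)%R]%E.
  have l2E w : l2norm (vmean (fun i => \row_j Y i j w) - vmean X) ^+ 2 =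
      \sum_j (\sum_i n%:R^-1 * (Y i j w - X i 0 j)) ^+ 2.
    rewrite l2norm_sqr; apply: eq_bigr => j _; congr (_ ^+ 2).
    rewrite !mxE !summxE -mulrBr -mulr_sumr sumrB; congr (_ * (_ - _)).
    by apply: eq_bigr => i _; rewrite mxE.
  rewrite /mean_squared_error (funext l2E) unlock.
  apply: ae_eq_integral => //.
  - apply/measurable_EFinP; apply: measurable_sum => j.
    apply: measurable_funX; apply: measurable_sum => i.
    by apply: measurable_funM => //; exact: measurable_funB.
  - apply/measurable_EFinP; apply: measurable_sum => j.
    by apply: measurable_funX; exact: measurable_sum.
  apply: filterS Yae => w Yw _; congr EFin; apply: eq_bigr => j _.
  congr (_ ^+ 2); apply: eq_bigr => i _.
  by rewrite (Yw (i, j)) mulrA.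
rewrite expectation_sumfun; last first.
  move=> j; rewrite (_ : (fun _ => _) = \sum_i \sum_i' g j i * g j i').
    by rewrite rpred_sum// => i _; rewrite rpred_sum.
  apply/funext => w; rewrite fct_sumE expr2 mulr_suml.
  by apply: eq_bigr => i _; rewrite mulr_sumr fct_sumE.
apply: (@le_trans _ _ (\sum_(j < d) (\sum_i v i)%:E)%E); first exact: lee_sum.
rewrite sumEFin lee_fin sumr_const card_ord -[leLHS]mulr_natl /v /h.
rewrite !mulr_sumr; apply: ler_sum => i _.
have /andP[smin smax] := hs i.
(* Nonnegativity is what allows squaring [s i <= Num.sqrt 2 * l2norm (X i)]. *)
have s0 : 0 <= s i.
  apply: le_trans smin; rewrite subr_ge0.
  exact: le_trans (coordmin_le hd (X i) (Ordinal hd)) (coordmax_ge hd _ _).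
have s2 : s i ^+ 2 <= 2 * l2norm (X i) ^+ 2.
  have -> : 2 * l2norm (X i) ^+ 2 = (Num.sqrt 2 * l2norm (X i)) ^+ 2.
    by rewrite exprMn (sqr_sqrtr (ler0n R 2)).
  by rewrite lerXn2r// nnegrE// (le_trans s0).
(* Both sides are [C] times a square term; the 2 from [s2] turns the 4 into the 2 of the claim. *)
pose C : R := d%:R / (4 * n%:R ^+ 2 * (k%:R - 1) ^+ 2).
have C0 : 0 <= C by rewrite divr_ge0 ?ler0n// mulr_ge0 ?sqr_ge0// mulr_ge0 ?sqr_ge0 ?ler0n.
have kn0 : k%:R - 1 != 0 :> R by rewrite gt_eqF.
rewrite [leLHS](_ : _ = C * s i ^+ 2); last by rewrite /C; field; rewrite kn0.
rewrite [leRHS](_ : _ = C * (2 * l2norm (X i) ^+ 2)); first exact: ler_wpM2l.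
by rewrite /C; field; rewrite kn0.
Qed.
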